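(* Let $\mathcal{E}$ be a finite-dimensional real Euclidean space, $\mathcal{K}\subseteq\mathcal{E}$ a closed convex cone, and let $\mathbf{z}\in\mathcal{K}^*$ be such that $\mathcal{F}=\{\mathbf{z}\}^\perp\cap\mathcal{K}$ is a nontrivial exposed face of $\mathcal{K}$. Let $\eta\ge0$, $\alpha\in(0,1]$ and let $\mathfrak{g}:\mathbb{R}_+\to\mathbb{R}_+$ be monotone nondecreasing with $\mathfrak{g}(0)=0$ and $\mathfrak{g}\ge|\cdot|^\alpha$. Define $$\gamma_{\mathbf{z},\eta}:=\inf_{\mathbf{v}}\left\{\frac{\mathfrak{g}(\|\mathbf{w}-\mathbf{v}\|)}{\|\mathbf{w}-\mathbf{u}\|}\;\Big|\;\mathbf{v}\in\partial\mathcal{K}\cap B(\eta)\setminus\mathcal{F},\ \mathbf{w}=P_{\{\mathbf{z}\}^\perp}\mathbf{v},\ \mathbf{u}=P_{\mathcal{F}}\mathbf{w},\ \mathbf{w}\ne\mathbf{u}\right\}.$$ Then the following statements hold. (i) If $\gamma_{\mathbf{z},\eta}\in(0,\infty]$, then $$\mathrm{d}(\mathbf{q},\mathcal{F})\le\kappa_{\mathbf{z},\eta}\,\mathfrak{g}(\mathrm{d}(\mathbf{q},\mathcal{K}))\quad\text{whenever } \mathbf{q}\in\{\mathbf{z}\}^\perp\cap B(\eta),$$ where $\kappa_{\mathbf{z},\eta}:=\max\{2\eta^{1-\alpha},2\gamma_{\mathbf{z},\eta}^{-1}\}<\infty$. (ii) If there exists $\kappa_B\in(0,\infty)$ such that $$\mathrm{d}(\mathbf{q},\mathcal{F})\le\kappa_B\,\mathfrak{g}(\mathrm{d}(\mathbf{q},\mathcal{K}))\quad\text{whenever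 } \mathbf{q}\in\{\mathbf{z}\}^\perp\cap B(\eta),$$ then $\gamma_{\mathbf{z},\eta}\in(0,\infty]$.
   Context: $\mathbb{R}_+=[0,\infty)$; $B(\eta)=\{\mathbf{x}\in\mathcal{E}:\|\mathbf{x}\|\le\eta\}$; $\mathrm{d}(\mathbf{x},C)=\inf_{\mathbf{y}\in C}\|\mathbf{x}-\mathbf{y}\|$; $P_C$ is the orthogonal projection onto a closed convex set $C$; $\partial\mathcal{K}$ is the boundary of $\mathcal{K}$; $\mathcal{K}^*=\{\mathbf{z}:\langle\mathbf{x},\mathbf{z}\rangle\ge0\ \forall\mathbf{x}\in\mathcal{K}\}$. A face of $\mathcal{K}$ is a closed convex cone $\mathcal{F}\subseteq\mathcal{K}$ such that $\mathbf{x},\mathbf{y}\in\mathcal{K}$, $\mathbf{x}+\mathbf{y}\in\mathcal{F}$ imply $\mathbf{x},\mathbf{y}\in\mathcal{F}$; it is nontrivial if $\mathcal{F}\ne\mathcal{K}$ and $\mathcal{F}\ne\mathcal{K}\cap-\mathcal{K}$; it is exposed if $\mathcal{F}=\mathcal{K}\cap\{\mathbf{z}\}^\perp$ for some $\mathbf{z}\in\mathcal{K}^*$. Conventions: the infimum over the empty set is $+\infty$ and $1/\infty=0$. *)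

(* Defs.v *)
From HB Require Import structures.
From mathcomp Require Import all_boot all_order all_algebra.
From mathcomp Require Import all_classical all_reals all_analysis.

Set Implicit Arguments.
Unset Strict Implicit.
Unset Printing Implicit Defensive.

Import Order.TTheory GRing.Theory Num.Theory.
Import numFieldNormedType.Exports.

Local Open Scope classical_set_scope.
Local Open Scope ring_scope.

(* A Euclidean space is a finite-dimensional normed space E together with a
   positive definite symmetric form ip : {dot E for idfun} inducing its norm. *)
#[short(type="normedVectType")]
HB.structure Definition NormedVector (R : numFieldType) :=
  {E of NormedModule R E & Vector R E}.

Section Cones.
Variables (R : realType) (E : normedVectType R) (ip : {dot E for idfun}).
Implicit Types (C K F : set E) (x z : E) (eta : R).

Definition norm_from_dot := forall x, `|x| ^+ 2 = ip x x.

(* The library's closed_ball is the closure of an open ball, so it is empty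
   when eta = 0. *)
Definition cball eta : set E := [set x | `|x| <= eta].

Definition dist x C : R := inf [set `|x - y| | y in C].

Definition is_proj C x p := C p /\ forall y, C y -> `|x - p| <= `|x - y|.

(* The value 0 is a default, taken only if no nearest point exists. *)
Definition proj C x : E := xget 0 (is_proj C x).

Definition bd C : set E := closure C `\` interior C.

Definition perp z : set E := [set x | ip x z = 0].

Definition dual_cone K : set E := [set z | forall x, K x -> 0 <= ip x z].

Definition closed_convex_cone K :=
  [/\ K !=set0, closed K, convex_set K
    & forall (a : R) x, 0 <= a -> K x -> K (a *: x)].

Definition is_face K F :=
  [/\ closed_convex_cone F, F `<=` K
    & forall x y, K x -> K y -> F (x + y) -> F x /\ F y].

Definition nontrivial_face K F :=
  [/\ is_face K F, F <> K & F <> K `&` [set - x | x in K]].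

Definition exposed_face K F :=
  is_face K F /\ exists2 z, dual_cone K z & F = K `&` perp z.

(* The infimum is taken in \bar R, so that it is +oo over the empty set. *)
Definition gamma K F z eta (g : R -> R) : \bar R :=
  ereal_inf [set t | exists v w u,
    [/\ (bd K `&` cball eta `\` F) v, w = proj (perp z) v, u = proj F w,
        w <> u & t = (g `|w - v| / `|w - u|)%:E]].

(* In \bar R the inverse of +oo is 0; in R the power 0 `^ 0 is 1. *)
Definition kappa K F z eta (alpha : R) (g : R -> R) : \bar R :=
  maxe (2 * eta `^ (1 - alpha))%:E (2%:E * (gamma K F z eta g)^-1)%E.

End Cones.

(* Main.v *)
(**
For (i), let q lie in the hyperplane orthogonal to z but not in K, and project
q to v in K, v to w in the hyperplane, and w to u in F.  Then v is a boundary
point of K with |v| <= |q| <= eta, and d = |q - v| = d(q, K) <= eta.  If v is in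
F, then d(q, F) <= d <= eta^(1-alpha) d^alpha.  Otherwise Pythagoras gives
|q - w| <= d and |w - v| <= d, so that
d(q, F) <= |q - w| + |w - u| <= d + g(d) / gamma.
For (ii), the error bound applied at q = w gives
|w - u| = d(w, F) <= kB g(d(w, K)) <= kB g(|w - v|), hence gamma >= 1 / kB.
Nearest points exist because E is finite-dimensional, so that closed bounded
sets are compact in coordinates.
*)
Require Import Defs.
From HB Require Import structures.
From mathcomp Require Import all_boot all_order all_algebra.
From mathcomp Require Import all_classical all_reals all_analysis.
From mathcomp Require Import ring lra.

Set Implicit Arguments.
Unset Strict Implicit.
Unset Printing Implicit Defensive.

Import Order.TTheory GRing.Theory Num.Theory.
Import numFieldNormedType.Exports.

Local Open Scope classical_set_scope.
Local Open Scope ring_scope.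

(** * Coordinates, compactness and the existence of nearest points *)

Section FiniteDimension.
Variables (R : realType) (E : normedVectType R).
Import VectorInternalTheory.

(** By linearity [r2v] is a finite sum of coordinates times fixed vectors. This lets compactness of
    sets of row vectors serve minimization in [E]. *)
Lemma r2v_continuous : continuous (@r2v R E).
Proof.
have r2v_sum : r2v = (fun a : 'rV[R]_(dim E) =>
    \sum_i a 0 i *: (r2v (delta_mx 0 i) : E)).
  apply/funext => a.
  rewrite [in LHS](row_sum_delta a) linear_sum.
  by apply: eq_bigr => i _; rewrite linearZ.
rewrite r2v_sum; apply: continuous_big => [|i _ a]; first exact: add_continuous.
apply: (@cvgZr_tmp _ _ _ (nbhs a)); exact: coord_continuous.
Qed.

(* The continuous function |r2v a| is positive on the compact unit sphere. *)
Lemma norm_r2v_lbound :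
  exists2 m : R, 0 < m & forall a : 'rV[R]_(dim E), m * `|a| <= `|r2v a : E|.
Proof.
pose S : set 'rV[R]_(dim E) := [set a | `|a| = 1].
have normalized (a : 'rV[R]_(dim E)) : a != 0 -> S (`|a|^-1 *: a).
  move=> a0; rewrite /S /= normrZ normfV normr_id mulVf //.
  by rewrite normr_eq0.
(* The sphere is empty only when 0 is the sole row vector; any positive constant then works. *)
have [S0|/set0P[a0 Sa0]] := eqVneq S set0.
  exists 1 => // a; have [->|/normalized] := eqVneq a 0.
    by rewrite normr0 mulr0.
  by rewrite S0.
have cS : compact S.
  apply: bounded_closed_compact.
    exists 1; split => // x x1 a /= ->; exact: ltW.
  have norm_cont : continuous (fun a : 'rV[R]_(dim E) => `|a|).
    by move=> a; exact: norm_continuous.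
  rewrite (_ : S = (fun a : 'rV[R]_(dim E) => `|a|) @^-1` [set (1 : R)]) //.
  by apply: preimage_closed; [move=> a _; exact: norm_cont|exact: closed_eq].
have cf : continuous (fun a : 'rV[R]_(dim E) => `|r2v a : E|).
  move=> a; apply: continuous_comp; first exact: r2v_continuous.
  exact: norm_continuous.
have [|c cS' minc] := compact_EVT_min _ cS (continuous_subspaceT cf).
  by exists a0.
exists `|r2v c : E|.
  rewrite normr_gt0; apply/eqP => c0.
  have : c = 0 by apply: (@r2v_inj _ E); rewrite c0 linear0.
  move=> {}c0; move: cS'; rewrite inE /S /= c0 normr0 => /eqP.
  by rewrite eq_sym oner_eq0.
move=> a; have [->|an0] := eqVneq a 0; first by rewrite normr0 mulr0.
have := minc (`|a|^-1 *: a); rewrite inE => /(_ (normalized _ an0)).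
by rewrite linearZ normrZ normfV normr_id ler_pdivlMl ?normr_gt0 // mulrC.
Qed.

(** Only points at least as near to x as a fixed c in [C] compete. Their coordinates form a closed
    set, bounded by [norm_r2v_lbound], so the distance attains its minimum there. *)
Lemma nearest_point_exists (C : set E) (x : E) :
  C !=set0 -> closed C -> exists p, is_proj C x p.
Proof.
move=> [c Cc] clC.
have cdist : continuous (fun a : 'rV[R]_(dim E) => `|x - r2v a|).
  move=> a; apply: (@cvg_norm _ _ _ (nbhs a)).
  apply: (@cvgB _ _ _ (nbhs a)); first exact: cvg_cst.
  exact: r2v_continuous.
pose A := [set a : 'rV[R]_(dim E) | C (r2v a) /\ `|x - r2v a| <= `|x - c|].
have cA : compact A.
  apply: bounded_closed_compact.
    have [m m0 mP] := norm_r2v_lbound.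
    exists ((`|x| + `|x - c|) / m); split; first exact: num_real.
    move=> M MP a [_ ac]; apply: le_trans (ltW MP).
    rewrite ler_pdivlMr // mulrC (le_trans (mP a)) //.
    rewrite -[r2v a](subrK x) (le_trans (ler_normD _ _)) // addrC lerD2l.
    by rewrite distrC.
  apply: closedI.
    by apply: preimage_closed clC => a _; exact: r2v_continuous.
  have : closed ((fun a : 'rV[R]_(dim E) => `|x - r2v a|) @^-1`
      [set y : R | y <= `|x - c|]).
    by apply: preimage_closed; [move=> a _; exact: cdist|exact: closed_le].
  exact.
have [|a aA mina] := compact_EVT_min _ cA (continuous_subspaceT cdist).
  by exists (v2r c); rewrite /A /= v2rK.
move: aA; rewrite inE => -[Ca ac].
exists (r2v a); split=> // y Cy.
have [xy|/ltW xy] := leP `|x - y| `|x - c|; last exact: le_trans ac xy.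
by rewrite -[y]v2rK; apply: mina; rewrite inE /A /= v2rK.
Qed.

End FiniteDimension.

(** * Projections onto hyperplanes, cones and closed sets *)

Section Projection.
Variables (R : realType) (E : normedVectType R).
Variables (ip : {dot E for idfun}) (hip : norm_from_dot ip).
Implicit Types (C F K : set E) (x y z : E).

Lemma dist_le C x y : C y -> dist x C <= `|x - y|.
Proof.
move=> Cy; apply: ge_inf; last by exists y.
by exists 0 => _ [u _ <-].
Qed.

Lemma is_proj_dist C x p : is_proj C x p -> dist x C = `|x - p|.
Proof.
move=> [Cp pP]; apply/eqP; rewrite eq_le dist_le //=.
apply: lb_le_inf; first by exists `|x - p|, p.
by move=> _ [y Cy <-]; exact: pP.
Qed.

Lemma is_proj_proj C x : C !=set0 -> closed C -> is_proj C x (Defs.proj C x).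
Proof. by move=> C0 clC; apply: xgetPex; exact: nearest_point_exists. Qed.

Lemma ipC x y : ip x y = ip y x.
Proof. by rewrite hermC expr0 mul1r. Qed.

Lemma normDZ_sqr x y (a : R) :
  `|x + a *: y| ^+ 2 = `|x| ^+ 2 + a * ip x y *+ 2 + a ^+ 2 * `|y| ^+ 2.
Proof.
rewrite !hip linearDl !linearDr /= !linearZl_LR /= !linearZr_LR /=.
by rewrite (ipC y x); ring.
Qed.

Lemma pythagoras x y : ip x y = 0 -> `|x + y| ^+ 2 = `|x| ^+ 2 + `|y| ^+ 2.
Proof. by move=> xy; rewrite -[y]scale1r normDZ_sqr scale1r xy; ring. Qed.

(** Since [proj] is a choice among nearest points, the explicit formula needs uniqueness: by
    Pythagoras any other point of the hyperplane is strictly farther from x. *)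
Lemma proj_perp z x : exists2 c : R,
  Defs.proj (perp ip z) x = x - c *: z & perp ip z (x - c *: z).
Proof.
(* For z = 0, c = 0 / 0 = 0, and x itself is the projection. *)
pose c := ip x z / ip z z.
have pz : perp ip z (x - c *: z).
  rewrite /perp /= linearBl /= linearZl_LR /= /c.
  have [->|z0] := eqVneq z 0; first by rewrite !linear0r subrr.
  by rewrite divfK ?subrr // gt_eqF // neq0_dnorm_gt0.
have split_norm y : perp ip z y ->
    `|x - y| ^+ 2 = `|x - c *: z - y| ^+ 2 + `|c *: z| ^+ 2.
  move=> zy; rewrite -pythagoras.
    by congr (`|_| ^+ 2); rewrite addrAC subrK.
  rewrite linearZr_LR /= linearBl /=.
  by rewrite (pz : ip _ z = 0) (zy : ip y z = 0) subrr mulr0.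
have proj_pz : is_proj (perp ip z) x (x - c *: z).
  split=> // y zy; rewrite -(@ler_pXn2r _ 2) ?nnegrE //.
  by rewrite (split_norm _ pz) (split_norm _ zy) subrr normr0 expr0n add0r lerDr
    sqr_ge0.
exists c => //; have [pw /(_ _ pz)] :
  is_proj (perp ip z) x (Defs.proj (perp ip z) x).
  by apply: xgetPex; exists (x - c *: z).
rewrite -(@ler_pXn2r _ 2) ?nnegrE // (split_norm _ pw) (split_norm _ pz).
rewrite subrr normr0 expr0n add0r gerDr => w0.
have : `|x - c *: z - Defs.proj (perp ip z) x| ^+ 2 == 0.
  by rewrite eq_le w0 sqr_ge0.
by rewrite sqrf_eq0 normr_eq0 subr_eq0 => /eqP.
Qed.

Lemma proj_perp_perp z x : perp ip z (Defs.proj (perp ip z) x).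
Proof. by have [c ->] := proj_perp z x. Qed.

Lemma proj_perp_pythagoras z x q : perp ip z q ->
  `|q - x| ^+ 2 = `|q - Defs.proj (perp ip z) x| ^+ 2
                + `|Defs.proj (perp ip z) x - x| ^+ 2.
Proof.
have [c -> pz zq] := proj_perp z x.
rewrite -pythagoras; first by rewrite addrA subrK.
rewrite (_ : x - c *: z - x = - c *: z); last first.
  by rewrite addrAC subrr add0r scaleNr.
rewrite linearZr_LR /= linearBl /=.
by rewrite (pz : ip _ z = 0) (zq : ip q z = 0) subrr mulr0.
Qed.

Lemma sqrD_le_components (a b c : R) : 0 <= a -> 0 <= b -> 0 <= c ->
  a ^+ 2 = b ^+ 2 + c ^+ 2 -> b <= a /\ c <= a.
Proof.
move=> a0 b0 c0 abc; split.
  by rewrite -(@ler_pXn2r _ 2) ?nnegrE // abc lerDl sqr_ge0.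
by rewrite -(@ler_pXn2r _ 2) ?nnegrE // abc lerDr sqr_ge0.
Qed.

Lemma cone0 K : closed_convex_cone K -> K 0.
Proof. by move=> [[x Kx] _ _ sK]; rewrite -(scale0r x); exact: sK. Qed.

Lemma proj_cone_norm_le K q v : closed_convex_cone K -> is_proj K q v ->
  `|v| <= `|q|.
Proof.
move=> [_ _ _ sK] [Kv vP].
(* The ray through v stays in [K], so |q - v|^2 <= |q - a v|^2; the term |q|^2 has been cancelled
   from both sides. *)
have near a : 0 <= a ->
    `|v| ^+ 2 - ip q v *+ 2 <= a ^+ 2 * `|v| ^+ 2 - a * ip q v *+ 2.
  move=> a0; have := vP _ (sK a v a0 Kv).
  rewrite -(@ler_pXn2r _ 2) ?nnegrE // -(scaleN1r v) -scaleNr.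
  by rewrite !normDZ_sqr; lra.
have [->|v0] := eqVneq v 0; first by rewrite normr0.
have B0 : 0 < `|v| ^+ 2 by rewrite exprn_gt0 // normr_gt0.
have A0 : 0 <= ip q v by have := near 0 (lexx _); rewrite expr0n !mul0r; lra.
(* Otherwise (<q, v> / |v|^2) v would be closer to q than v is. *)
have AB : ip q v = `|v| ^+ 2.
  have := near (ip q v / `|v| ^+ 2) (divr_ge0 A0 (ltW B0)).
  set A := ip q v in A0 *; set B := `|v| ^+ 2 in B0 *.
  rewrite [leRHS](_ : _ = - (A ^+ 2 / B)); last by field; exact: lt0r_neq0.
  rewrite -(ler_pM2r B0) mulNr divfK ?gt_eqF // => AB.
  have : (A - B) ^+ 2 <= 0 by nra.
  by rewrite exprn_even_le0 //= subr_eq0 => /eqP.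
(* As q - v is orthogonal to v, the nonnegative |q - v|^2 equals |q|^2 - |v|^2. *)
have := sqr_ge0 `|q - v|; rewrite -scaleN1r normDZ_sqr AB => qv.
by rewrite -(@ler_pXn2r _ 2) ?nnegrE //; lra.
Qed.

(** From an interior point v, a short move towards q would stay in [C] and come strictly closer to
    q. *)
Lemma is_proj_bd C q v : closed C -> ~ C q -> is_proj C q v -> bd C v.
Proof.
move=> clC nCq [Cv vP]; split; first exact: subset_closure.
move=> /nbhs_ballP[e /= e0 eC].
have qv0 : 0 < `|q - v|.
  by rewrite normr_gt0 subr_eq0; apply: contra_notN nCq => /eqP ->.
(* The factor e / 2 keeps the moved point in the open ball; the cap at 1 avoids overshooting q. *)
pose t := Num.min 1 (e / 2 / `|q - v|).
have t0 : 0 < t by rewrite lt_min ltr01 !divr_gt0.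
have t1 : t <= 1 by rewrite ge_min lexx.
have tqv : t * `|q - v| < e.
  apply: (@le_lt_trans _ _ (e / 2)); last first.
    by rewrite ltr_pdivrMr // ltr_pMr // ltr1n.
  by rewrite -ler_pdivlMr // ge_min lexx orbT.
have /vP : C (v + t *: (q - v)).
  apply: eC; rewrite -ball_normE /ball_ /=.
  by rewrite opprD addrA subrr add0r normrN normrZ gtr0_norm.
rewrite opprD addrA -{2}(scale1r (q - v)) -scalerBl normrZ.
rewrite ger0_norm ?subr_ge0 //.
by rewrite ler_pMl // lerBrDr gerDl leNgt t0.
Qed.

End Projection.

(** * Scalar estimates and the two directions of the error bound *)

Lemma le_powR_split (R : realType) (alpha t eta : R) :
  alpha <= 1 -> 0 <= t -> t <= eta -> t <= eta `^ (1 - alpha) * t `^ alpha.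
Proof.
move=> alpha1; rewrite le_eqVlt => /predU1P[<- _|t0 teta].
  by rewrite mulr_ge0 ?powR_ge0.
(* Split t as t^(1-alpha) t^alpha; t = 0 was set apart because exponents need not add at base 0. *)
rewrite -[leLHS](powRr1 (ltW t0)) -{1}(subrK alpha 1) powRD.
  rewrite ler_wpM2r ?powR_ge0 // ge0_ler_powR ?subr_ge0 ?nnegrE ?(ltW t0) //.
  exact: le_trans (ltW t0) teta.
by rewrite (gt_eqF t0) implybT.
Qed.

(** Applied to [gamma], this gives one real r for both the finite and the infinite case: for +oo, r
    = 0 and the last premise is never met. *)
Lemma inve_gt0_bound (R : realType) (x : \bar R) : (0 < x)%E ->
  exists2 r : R, 0 <= r /\ (x^-1)%E = r%:E &
    forall s t : R, 0 <= s -> 0 < t -> (x <= (s / t)%:E)%E -> t <= r * s.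
Proof.
case: x => [x|_|//]; last by exists 0; rewrite ?invey.
rewrite lte_fin => x0; exists x^-1.
  by rewrite inver gt_eqF // invr_ge0 ltW.
move=> s t s0 t0; rewrite lee_fin ler_pdivlMr // => xts.
by rewrite ler_pdivlMl.
Qed.

Theorem theorem3p10 (R : realType) (E : normedVectType R)
  (ip : {dot E for idfun}) (hip : norm_from_dot ip)
  (K : set E) (hK : closed_convex_cone K)
  (z : E) (hz : dual_cone ip K z)
  (F : set E) (hF : F = perp ip z `&` K)
  (hFe : exposed_face ip K F) (hFn : nontrivial_face K F)
  (eta : R) (heta : 0 <= eta)
  (alpha : R) (halpha0 : 0 < alpha) (halpha1 : alpha <= 1)
  (g : R -> R) (g_ge0 : forall t : R, 0 <= t -> 0 <= g t)
  (g_mono : forall s t : R, 0 <= s -> s <= t -> g s <= g t)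
  (g0 : g 0 = 0) (g_pow : forall t : R, 0 <= t -> `|t| `^ alpha <= g t) :
  ((0 < gamma ip K F z eta g)%E ->
     (kappa ip K F z eta alpha g < +oo)%E /\
     forall q, perp ip z q -> cball eta q ->
       ((dist q F)%:E <= kappa ip K F z eta alpha g * (g (dist q K))%:E)%E)
  /\
  ((exists2 kB : R, 0 < kB &
      forall q, perp ip z q -> cball eta q ->
        dist q F <= kB * g (dist q K)) ->
   (0 < gamma ip K F z eta g)%E).
Proof.
have [K0 clK _ _] := hK; have [[coneF _ _] _] := hFe.
have [F0 clF _ _] := coneF.
have FE q : perp ip z q -> K q -> F q by rewrite hF.
have g_dist0 q : 0 <= g (dist q K).
  by rewrite (is_proj_dist (is_proj_proj q K0 clK)) g_ge0.
split.
- move=> /inve_gt0_bound[r [r0 rE] rP].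
  have kE : kappa ip K F z eta alpha g =
      (Num.max (2 * eta `^ (1 - alpha)) (2 * r))%:E.
    by rewrite /kappa rE -EFinM EFin_max.
  rewrite kE; split; first exact: ltry.
  move=> q zq qeta; rewrite -EFinM lee_fin.
  have eta_powR0 : 0 <= eta `^ (1 - alpha) by exact: powR_ge0.
  have [Kq|nKq] := pselect (K q).
    rewrite (le_trans (dist_le _ (FE q zq Kq))) // subrr normr0.
    by rewrite mulr_ge0 // le_max mulr_ge0.
  have projv := is_proj_proj q K0 clK.
  set v := Defs.proj K q in projv.
  have [Kv vP] := projv.
  rewrite (is_proj_dist projv); set d := `|q - v|.
  have d_eta : d <= eta.
    apply: le_trans qeta; have := vP _ (cone0 hK).
    by rewrite subr0.
  have d_le : d <= eta `^ (1 - alpha) * g d.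
    apply: le_trans (le_powR_split halpha1 (normr_ge0 _) d_eta) _.
    rewrite ler_wpM2l //.
    by have := g_pow _ (normr_ge0 (q - v)); rewrite normr_id.
  have gd0 : 0 <= g d by apply: g_ge0; exact: normr_ge0.
  (* A sum of two terms is at most twice their maximum, whence the factors 2 in [kappa]. *)
  have dist_bound : dist q F <= eta `^ (1 - alpha) * g d + r * g d; last first.
    apply: le_trans dist_bound _; rewrite -mulrDl ler_wpM2r //.
    rewrite le_max; case: (leP r (eta `^ (1 - alpha))) => ?.
      by apply/orP; left; lra.
    by apply/orP; right; lra.
  have rgd0 : 0 <= r * g d by rewrite mulr_ge0.
  have [Fv|nFv] := pselect (F v).
    by apply: le_trans (dist_le q Fv) _; rewrite -/d; lra.
  pose w := Defs.proj (perp ip z) v; pose u := Defs.proj F w.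
  have [Fu _] : is_proj F w u by exact: is_proj_proj.
  have [qw wv] : `|q - w| <= d /\ `|w - v| <= d.
    apply: sqrD_le_components (proj_perp_pythagoras hip v zq); exact: normr_ge0.
  apply: le_trans (dist_le q Fu) _.
  have -> : q - u = (q - w) + (w - u) by rewrite addrA subrK.
  apply: le_trans (ler_normD _ _) _; apply: lerD; first exact: le_trans qw d_le.
  (* The infimum ignores points with w = u, but then the term |w - u| vanishes. *)
  have [->|/eqP wu] := eqVneq w u; first by rewrite subrr normr0.
  apply: (@le_trans _ _ (r * g `|w - v|)); last first.
    by rewrite ler_wpM2l // g_mono.
  apply: rP; first exact: g_ge0.
    by rewrite normr_gt0 subr_eq0; exact/eqP.
  apply: ereal_inf_lbound; exists v, w, u; split=> //.
  split=> //; split; first exact: is_proj_bd projv.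
  exact: le_trans (proj_cone_norm_le hip hK projv) qeta.
- move=> [kB kB0 kBP].
  apply: (@lt_le_trans _ _ (kB^-1)%:E); first by rewrite lte_fin invr_gt0.
  apply: le_ereal_inf_tmp => _ [v [w [u [[[[Kv _] veta] nFv] wE uE wu ->]]]].
  have {}Kv : K v by rewrite (closure_id K).1.
  have projw : is_proj F w u by rewrite uE; exact: is_proj_proj.
  have zw : perp ip z w by rewrite wE; exact: proj_perp_perp.
  (* Pythagoras with base point 0 of the hyperplane shows that w stays in the ball, so the error
     bound applies to it. *)
  have [_ wv] : `|w - v| <= `|v| /\ `|w| <= `|v|.
    apply: sqrD_le_components => //.
    have := proj_perp_pythagoras hip v (_ : perp ip z 0).
    rewrite -wE !sub0r !normrN addrC; apply.
    by rewrite /perp /= linear0l.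
  have := kBP w zw (le_trans wv veta); rewrite (is_proj_dist projw) => wukB.
  rewrite lee_fin ler_pdivlMr ?normr_gt0 ?subr_eq0; last exact/eqP.
  rewrite ler_pdivrMl //; apply: le_trans wukB _.
  rewrite ler_wpM2l ?(ltW kB0) // g_mono //; last exact: dist_le.
  by rewrite (is_proj_dist (is_proj_proj w K0 clK)).
Qed.
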